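(* Let $\mathcal{H},\mathcal{G}$ be real Hilbert spaces, let $f\colon\mathcal{H}\to\mathbb{R}\cup\{\infty\}$ and $g\colon\mathcal{G}\to\mathbb{R}\cup\{\infty\}$ be proper, convex, and lower semicontinuous, let $L\colon\mathcal{H}\to\mathcal{G}$ be a nonzero bounded linear operator, and assume that there exists at least one KKT point. Let $\theta>1/2$ and $\tau,\sigma>0$ satisfy $\tau\sigma\|L\|^2<4/(1+2\theta)$. Let $(x_0,y_0)\in\mathcal{H}\times\mathcal{G}$ be arbitrary and let $(x_k)_{k=0}^\infty$, $(y_k)_{k=0}^\infty$ be generated by the Chambolle--Pock iteration with parameters $\tau,\sigma,\theta$. Then there is a KKT point $(x_\star,y_\star)\in\mathcal{H}\times\mathcal{G}$ such that $(x_k,y_k)$ converges weakly to $(x_\star,y_\star)$ as $k\to\infty$.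
   Context: $\|L\|$ is the operator norm and $L^*$ the adjoint of $L$. The convex conjugate of $g$ is $g^*(u)=\sup_{y\in\mathcal{G}}(\langle u,y\rangle-g(y))$. The subdifferential of a proper convex lower semicontinuous $h$ is $\partial h(x)=\{u : h(z)\ge h(x)+\langle u,z-x\rangle \text{ for all } z\}$, and its proximal operator with step size $\gamma>0$ is $\mathrm{Prox}^{\gamma}_{h}(x)=\operatorname{argmin}_{z}\left(h(z)+\frac{1}{2\gamma}\|z-x\|^2\right)$ (uniquely defined). A KKT point is a pair $(x_\star,y_\star)\in\mathcal{H}\times\mathcal{G}$ with $-L^*y_\star\in\partial f(x_\star)$ and $Lx_\star\in\partial g^*(y_\star)$. The Chambolle--Pock iteration is, for $k=0,1,2,\dots$, $$x_{k+1}=\mathrm{Prox}^{\tau}_{f}(x_k-\tau L^*y_k),\qquad y_{k+1}=\mathrm{Prox}^{\sigma}_{g^*}\bigl(y_k+\sigma L(x_{k+1}+\theta(x_{k+1}-x_k))\bigr).$$ *)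

(* Defs.v *)
From HB Require Import structures.
From mathcomp Require Export all_boot all_order all_algebra.
From mathcomp Require Export sesquilinear.
From mathcomp Require Export all_classical all_reals all_analysis.

Set Implicit Arguments.
Unset Strict Implicit.
Unset Printing Implicit Defensive.

Import Order.TTheory GRing.Theory Num.Theory.
Import numFieldNormedType.Exports.

Local Open Scope classical_set_scope.
Local Open Scope ring_scope.

(* Real Hilbert spaces: complete normed modules whose norm is induced by a
   symmetric positive definite bilinear form. *)
HB.mixin Record NormedModule_isHilbert (R : realType) (V : Type)
    of NormedModule R V := {
  inner : {dot V for @idfun R} ;
  inner_normE : forall x : V, inner x x = `|x| ^+ 2
}.

#[short(type="hilbertType")]
HB.structure Definition Hilbert (R : realType) :=
  {V of NormedModule_isHilbert R V & CompleteNormedModule R V}.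

Section operators.
Context {R : realType} {H G : hilbertType R}.

Definition bounded_operator (L : H -> G) : Prop :=
  exists M : R, forall x, `|L x| <= M * `|x|.

Definition opnorm (L : H -> G) : R :=
  sup [set `|L x| | x in [set x : H | `|x| <= 1]].

(* For a bounded linear L, the set below is a singleton by Riesz
   representation, so that get returns its unique element. *)
Definition adjoint (L : H -> G) (y : G) : H :=
  get [set u : H | forall x, inner (L x) y = inner x u].

End operators.

Section convex_analysis.
Context {R : realType} {H : hilbertType R}.
Local Open Scope ereal_scope.
Implicit Type h : H -> \bar R.

Definition proper_ereal h : Prop :=
  (forall x, -oo < h x) /\ (exists x, h x < +oo).

(* The open range of t avoids products with 0; for functions never equal
   to -oo, the right-hand side is never of the form +oo - oo. *)
Definition convex_ereal h : Prop :=
  forall (x y : H) (t : R), (0 < t < 1)%R ->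
    h (t *: x + (1 - t) *: y)%R <= t%:E * h x + (1 - t)%:E * h y.

Definition conjugate h (u : H) : \bar R :=
  ereal_sup (range (fun y : H => (inner u y)%:E - h y)).

Definition subdifferential h (x : H) : set H :=
  [set u | forall z, h x + (inner u (z - x)%R)%:E <= h z].

Definition argmin (phi : H -> \bar R) : set H :=
  [set p | forall z, phi p <= phi z].

(* For h proper, convex and lower semicontinuous and gamma > 0, the argmin is
   a singleton, so that get returns its unique element. *)
Definition prox (gamma : R) h (x : H) : H :=
  get (argmin (fun z => h z + ((2 * gamma)^-1 * `|z - x| ^+ 2)%R%:E)).

End convex_analysis.

(* Continuous linear functionals only depend on the topology of V; hence for
   H * G, with H and G Hilbert spaces, the library's maximum norm gives the weak
   convergence of the Hilbert product H x G, whose norm is equivalent. *)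
Definition weakly_cvg {R : realType} {V : normedModType R}
    (u : nat -> V) (l : V) : Prop :=
  forall phi : {linear V -> R^o}, continuous phi ->
    phi (u k) @[k --> \oo] --> phi l.

Section chambolle_pock.
Context {R : realType} {H G : hilbertType R}.

Definition KKT_point (f : H -> \bar R) (g : G -> \bar R) (L : H -> G)
    (p : H * G) : Prop :=
  subdifferential f p.1 (- adjoint L p.2) /\
  subdifferential (conjugate g) p.2 (L p.1).

Definition chambolle_pock (f : H -> \bar R) (g : G -> \bar R) (L : H -> G)
    (tau sigma theta : R) (x : nat -> H) (y : nat -> G) : Prop :=
  forall k,
    x k.+1 = prox tau f (x k - tau *: adjoint L (y k)) /\
    y k.+1 = prox sigma (conjugate g)
               (y k + sigma *: L (x k.+1 + theta *: (x k.+1 - x k))).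

End chambolle_pock.

(* Main.v *)
(* Let [(xs, ys)] be a KKT point, [F >= 0] the function [f] tilted by
   [L^* ys] so that it vanishes at [xs], and
   [w_k = (x_(k+1) - x_k) / tau - L^* (y_(k+1) - y_k)].  The quantity
     |x_k - xs|^2 / (2 tau) + |y_k - ys|^2 / (2 sigma)
       - <L (x_k - xs), y_k - ys> + (theta - 1) F(x_k) + tau/4 |w_(k-1)|^2
   decreases: add the subgradient inequalities at [x_(k+1)] and [y_(k+1)]
   tested at the KKT point, [theta - 1/2] times the one at [x_(k+1)] tested at
   [x_k], and [1/2] times the one at [x_k] tested at [x_(k+1)].  The decrease
   controls the increments of both sequences, and the quantity is bounded below
   because half of the coupling term is dominated through the subgradient
   inequality at [x_k].
   Weak limits are taken along ultrafilters, which replaces the extraction of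
   weakly convergent subsequences: every bounded real sequence converges along
   an ultrafilter, and Riesz representation gives the weak limit.  Such limits
   are KKT points by Minty's trick, and an Opial argument shows that they all
   coincide. *)

From mathcomp Require Import ring lra.
Require Import Defs.

Set Implicit Arguments.
Unset Strict Implicit.
Unset Printing Implicit Defensive.

Import Order.TTheory GRing.Theory Num.Theory.
Import numFieldNormedType.Exports.

Local Open Scope classical_set_scope.
Local Open Scope ring_scope.

(** * Inner products *)

Section inner_product.
Context {R : realType} {H : hilbertType R}.
Implicit Types (x y z : H) (a : R).

Lemma innerC x y : inner x y = inner y x.
Proof. by rewrite hermC expr0 mul1r. Qed.

Lemma innerDl x y z : inner (x + y) z = inner x z + inner y z.
Proof. exact: linearDl. Qed.

Lemma innerDr x y z : inner z (x + y) = inner z x + inner z y.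
Proof. exact: linearDr. Qed.

Lemma innerZl a x y : inner (a *: x) y = a * inner x y.
Proof. exact: linearZl_LR. Qed.

Lemma innerZr a x y : inner x (a *: y) = a * inner x y.
Proof. exact: linearZr_LR. Qed.

Lemma innerNl x y : inner (- x) y = - inner x y.
Proof. exact: linearNl. Qed.

Lemma innerNr x y : inner x (- y) = - inner x y.
Proof. exact: linearNr. Qed.

Lemma inner0l x : inner 0 x = 0.
Proof. exact: linear0l. Qed.

Lemma inner0r x : inner x 0 = 0.
Proof. exact: linear0r. Qed.

Definition innerE :=
  (innerDl, innerDr, innerNl, innerNr, innerZl, innerZr, inner0l, inner0r).

Lemma inner_ge0 x : 0 <= inner x x.
Proof. by rewrite inner_normE sqr_ge0. Qed.

Lemma inner_inj x y : (forall z, inner z x = inner z y) -> x = y.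
Proof.
move=> h; apply/eqP; rewrite -subr_eq0 -normr_eq0 -sqrf_eq0 -inner_normE.
by rewrite innerDr innerNr h subrr.
Qed.

Lemma cauchy_schwarz x y : `|inner x y| <= `|x| * `|y|.
Proof.
rewrite -(@ler_pXn2r _ 2) ?nnegrE ?mulr_ge0 // exprMn real_normK ?num_real //.
have [->|y0] := eqVneq y 0; first by rewrite inner0r normr0 !expr0n /= mulr0.
have ny : 0 < `|y| ^+ 2 by rewrite exprn_gt0// normr_gt0.
(* This vector is |y|^2 times the component of [x] orthogonal to [y]; its squared norm is |y|^2
   times the gap in the claim. *)
have := inner_ge0 (`|y| ^+ 2 *: x - inner x y *: y).
rewrite !innerE !inner_normE (innerC y x) => h.
by rewrite -(ler_pM2l ny); lra.
Qed.

Lemma inner_continuous y : continuous (fun x => inner x y : R^o).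
Proof.
move=> x; apply/cvgrPdist_lt => e e0.
near=> z; rewrite -innerNl -innerDl (le_lt_trans (cauchy_schwarz _ _))//.
have : `|x - z| < e / (`|y| + 1).
  near: z; apply: (@cvgr_dist_lt _ _ _ _ _ id x) => //.
  by rewrite divr_gt0// ltr_wpDl.
rewrite ltr_pdivlMr ?ltr_wpDl// => h; apply: le_lt_trans h.
by rewrite ler_wpM2l// lerDl.
Unshelve. all: by end_near. Qed.

End inner_product.
(** * Proximal points and subgradients *)

Section prox_existence.
Context {R : realType} {H : hilbertType R}.
Implicit Types (h : H -> \bar R) (x y z : H) (a b c t : R).

Lemma proper_fineK h z a : proper_ereal h -> (h z <= a%:E)%E ->
  h z = (fine (h z))%:E.
Proof.
move=> [hp _] hz; rewrite fineK// fin_numE gt_eqF ?hp//=.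
by rewrite lt_eqF// (le_lt_trans hz) ?ltry.
Qed.

Lemma proper_finite h : proper_ereal h -> exists z a, h z = a%:E.
Proof.
move=> hp; have [hgt [z hz]] := hp; exists z, (fine (h z)).
by rewrite fineK// fin_numE gt_eqF ?hgt//= lt_eqF.
Qed.

Lemma lsc_addr h (q : H -> R^o) : lower_semicontinuous h -> continuous q ->
  lower_semicontinuous (fun z => h z + (q z)%:E)%E.
Proof.
move=> hl qc x a ahq.
have [b ab bh] : exists2 b, a - q x < b & (b%:E < h x)%E.
  case: (h x) ahq => [r||//] /=.
    rewrite -EFinD lte_fin => ar; exists ((a - q x + r) / 2); first lra.
    by rewrite lte_fin; lra.
  by exists (a - q x + 1); [lra | rewrite ltry].
have [V Vx hV] := hl _ _ bh.
have qx : nbhs x [set z | a - b < q z].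
  by apply: (cvgr_gt (q x)); [exact: qc | lra].
exists (V `&` [set z | a - b < q z]); first exact: filterI.
move=> y [/hV hy /= qy]; apply: (@lt_trans _ _ (b + q y)%:E).
  by rewrite lte_fin; lra.
by rewrite EFinD lte_leD// ?fin_numE.
Qed.

(** A cone below [h] suffices for the prox, because the quadratic term dominates it, and no
    separation theorem is needed. Lower semicontinuity bounds [h] below on a ball of radius [e]
    about [x]; convexity along rays from [x] carries the bound outside with slope [e^-1]. *)
Lemma affine_minorant h : proper_ereal h -> convex_ereal h ->
  lower_semicontinuous h ->
  exists x a b, 0 <= b /\ forall z, ((a - b * `|z - x|)%:E <= h z)%E.
Proof.
move=> hp hc hl; have [x [r0 hx]] := proper_finite hp.
have [|V Vx hV] := hl x (r0 - 1); first by rewrite hx lte_fin; lra.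
have [e e0 eV] : exists2 e, 0 < e & forall z, `|z - x| <= e -> ((r0 - 1)%:E < h z)%E.
  have /nbhs_ballP[e /= e0 eV] := Vx.
  exists (e / 2); first lra.
  move=> z ze; apply/hV/eV; rewrite /= -ball_normE /= distrC; lra.
exists x, (r0 - 1), e^-1; rewrite invr_ge0 (ltW e0); split=> // z.
have [ze|ze] := leP `|z - x| e.
  rewrite (le_trans _ (ltW (eV _ ze)))// lee_fin lerBlDr lerDl.
  by rewrite mulr_ge0// invr_ge0 ltW.
have z0 : 0 < `|z - x| by lra.
set t := e / `|z - x|.
have t01 : 0 < t < 1 by rewrite divr_gt0//= ltr_pdivrMr// mul1r.
have /andP[t0 t1] := t01.
have zt : `|t *: z + (1 - t) *: x - x| = e.
  rewrite scalerBl scale1r addrA addrAC addrK -scalerBr normrZ gtr0_norm//.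
  by rewrite /t divfK// gt_eqF.
have := hc z x t t01; rewrite hx.
move: (eV (t *: z + (1 - t) *: x)); rewrite zt lexx => /(_ isT).
have := hp.1 z; case: (h z) => [s _||//]; last by rewrite leey.
move=> /lt_le_trans /[apply]; rewrite -!EFinM -EFinD lte_fin lee_fin => ts.
have -> : e^-1 * `|z - x| = t^-1 by rewrite /t invf_div mulrC.
by rewrite -(ler_pM2l t0) mulrBr mulfV ?gt_eqF//; lra.
Qed.

Lemma sqr_norm_continuous c x : continuous (fun z => c * `|z - x| ^+ 2 : R^o).
Proof.
move=> z; apply: cvgMr; apply: cvgM; apply: cvg_norm;
  by apply: cvgB; [exact: cvg_id | exact: cvg_cst].
Qed.

Lemma sqr_norm_midpoint x y z :
  `|(2^-1 : R) *: y + (1 - 2^-1) *: z - x| ^+ 2 =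
  `|y - x| ^+ 2 / 2 + `|z - x| ^+ 2 / 2 - `|y - z| ^+ 2 / 4.
Proof.
rewrite -!inner_normE !innerE (innerC y x) (innerC z x) (innerC z y).
by field.
Qed.

(** The near-minimizers form a Cauchy filter by strong convexity of the quadratic term; completeness
    gives a limit, and lower semicontinuity makes it a minimizer. *)
Lemma prox_argmin_ex h c x : 0 < c -> proper_ereal h -> convex_ereal h ->
  lower_semicontinuous h ->
  argmin (fun z => h z + (c * `|z - x| ^+ 2)%:E)%E !=set0.
Proof.
move=> c0 hp hc hl; pose q z : R^o := c * `|z - x| ^+ 2.
pose E : set R := [set r | exists2 z, h z = (r - q z)%:E & True].
have [x0 [a [b [b0 hab]]]] := affine_minorant hp hc hl.
(* The constant comes from completing the square in |z - x|, which absorbs the linear loss of the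
   cone. *)
have Elb : lbound E (a - b * `|x - x0| - b ^+ 2 / (4 * c)).
  move=> r [z hz _]; have := hab z; rewrite hz lee_fin => hz'.
  have : `|z - x0| <= `|z - x| + `|x - x0| by exact: ler_distD.
  move=> /(ler_wpM2l b0) hd.
  suff : 0 <= q z - b * `|z - x| + b ^+ 2 / (4 * c) by lra.
  have -> : q z - b * `|z - x| + b ^+ 2 / (4 * c) =
      c * (`|z - x| - b / (2 * c)) ^+ 2 by rewrite /q; field; lra.
  by rewrite mulr_ge0 ?sqr_ge0// ltW.
have Einf : has_inf E.
  split; last by eexists; exact: Elb.
  have [z [r hz]] := proper_finite hp.
  by exists (r + q z), z => //; rewrite addrK.
set m := inf E.
have mE r z : h z = r%:E -> m <= r + q z.
  by move=> hz; apply: inf_lbound; [exact: Einf.2 | exists z; rewrite ?addrK].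
pose S e := [set z | exists2 r, h z = r%:E & r + q z < m + e].
have S0 e : 0 < e -> S e !=set0.
  move=> e0; have [r [z hz _] re] := inf_adherent e0 Einf.
  by exists z, (r - q z); rewrite ?subrK.
pose F := filter_from [set e : R | 0 < e] S.
have FF : ProperFilter F.
  apply: filter_from_proper => //; apply: filter_from_filter.
    by exists 1 => /=.
  move=> e1 e2 /= e10 e20; exists (Num.min e1 e2); first by rewrite /= lt_min e10.
  move=> z [r hz]; rewrite -ltrBlDl lt_min => /andP[r1 r2].
  by split; exists r; rewrite // -ltrBlDl.
(* The midpoint of [y] and [z] has value at least [m], yet at most [m + e] minus c/4 |y - z|^2. *)
have Sdist e y z : S e y -> S e z -> c * `|y - z| ^+ 2 <= 4 * e.
  move=> [r hy hr] [s hz hs].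
  have half : 0 < (2^-1 : R) < 1 by lra.
  have := hc y z _ half; rewrite hy hz -!EFinM -EFinD => hm.
  have hmE := proper_fineK hp hm; move: hm; rewrite hmE lee_fin => hm.
  have := mE _ _ hmE; rewrite /q sqr_norm_midpoint => mle.
  move: hr hs; rewrite /q => hr hs; lra.
have /cvg_ex[p Fp] : cvg F.
  apply: cauchy_cvg; apply: cauchy_exP => e e0.
  have e'0 : 0 < c * e ^+ 2 / 8 by rewrite divr_gt0// mulr_gt0// exprn_gt0.
  have [y Sy] := S0 _ e'0; exists y; exists (c * e ^+ 2 / 8) => //.
  move=> z /(Sdist _ _ _ Sy) yz; rewrite /= -ball_normE /=.
  rewrite -(@ltr_pXn2r _ 2) ?nnegrE ?(ltW e0)//.
  have ce0 : 0 < c * e ^+ 2 by rewrite mulr_gt0// exprn_gt0.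
  by rewrite -(ltr_pM2l c0); lra.
have ml z : (m%:E <= h z + (q z)%:E)%E.
  case hz : (h z) (hp.1 z) => [r||] // _; last by rewrite addye ?leey.
  by rewrite -EFinD lee_fin mE.
(* Otherwise the objective stays above some [d > m] on a neighbourhood of [p], which contains
   near-minimizers of value below [d]. *)
exists p => z; apply: le_trans (ml z); rewrite leNgt; apply/negP => mp.
have [d md dp] : exists2 d, m < d & (d%:E < h p + (q p)%:E)%E.
  move: mp; case: (h p + (q p)%:E)%E => [r|_|//].
    by rewrite lte_fin => mr; exists ((m + r) / 2); rewrite ?lte_fin; lra.
  by exists (m + 1); rewrite ?ltry//; lra.
have [V Vp hV] := lsc_addr hl (@sqr_norm_continuous c x) dp.
have [e /= e0 eV] := Fp _ Vp.
have [|y [r hy]] := S0 (Num.min e (d - m)); first by rewrite lt_min e0; lra.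
rewrite -ltrBlDl lt_min => /andP[re rd].
have Sy : S e y by exists r; rewrite // -ltrBlDl.
by have := hV _ (eV _ Sy); rewrite hy -EFinD lte_fin -/(q y); lra.
Qed.

Lemma proxP h c x : 0 < c -> proper_ereal h -> convex_ereal h ->
  lower_semicontinuous h ->
  subdifferential h (prox c h x) (c^-1 *: (x - prox c h x)).
Proof.
move=> c0 hp hc hl; set p := prox c h x.
have k0 : 0 < (2 * c)^-1 by rewrite invr_gt0; lra.
have pmin : argmin (fun z => h z + ((2 * c)^-1 * `|z - x| ^+ 2)%:E)%E p.
  by apply: getPex; exact: prox_argmin_ex.
have [r hpr] : exists r, h p = r%:E.
  have [z [a hz]] := proper_finite hp; move: (pmin z); rewrite hz.
  case: (h p) (hp.1 p) => [r _ _|//|//]; by exists r.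
move=> z; case hz : (h z) (hp.1 z) => [s||] // _; last by rewrite leey.
rewrite hpr -EFinD lee_fin innerZl.
(* Compare [p] with [p + t (z - p)], bound [h] there by convexity and divide by [t]; the remainder
   is of order [t]. *)
have main t : 0 < t < 1 ->
    r - s <= c^-1 * inner (p - x) (z - p) + t * ((2 * c)^-1 * `|z - p| ^+ 2).
  move=> t01; have /andP[t0 t1] := t01.
  have := hc z p t t01; rewrite hz hpr -!EFinM -EFinD => hm.
  have hmE := proper_fineK hp hm; move: hm; rewrite hmE lee_fin => hm.
  have := pmin (t *: z + (1 - t) *: p); rewrite hmE hpr -!EFinD lee_fin.
  have -> : t *: z + (1 - t) *: p - x = (p - x) + t *: (z - p).
    by rewrite scalerBl scale1r scalerBr addrCA addrAC.
  have -> : `|p - x + t *: (z - p)| ^+ 2 = `|p - x| ^+ 2 +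
      t * (2 * inner (p - x) (z - p) + t * `|z - p| ^+ 2).
    rewrite -!inner_normE; move: (p - x) (z - p) => u v.
    by rewrite !innerE (innerC v u); ring.
  move=> pm; rewrite -(ler_pM2l t0).
  set A := inner _ _ in pm *; set B := `|z - p| ^+ 2 in pm *.
  have -> : t * (c^-1 * A + t * ((2 * c)^-1 * B)) =
     (2 * c)^-1 * (t * (2 * A + t * B)) by field; lra.
  rewrite mulrDr in pm; lra.
rewrite -(opprB p x) innerNl mulrN.
set A := c^-1 * _ in main *; set B := (2 * c)^-1 * _ in main.
have B0 : 0 <= B by rewrite mulr_ge0// ltW.
rewrite -subr_ge0 -lerN2 oppr0; apply/ler_addgt0Pr => e e0.
(* The second entry of the minimum keeps the remainder [t * B] below [e]. *)
have t01 : 0 < Num.min (1 / 2) (e / (B + 1)) < 1.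
  by rewrite lt_min gt_min divr_gt0 ?divr_gt0 //=; lra.
have := main _ t01.
have : Num.min (1 / 2) (e / (B + 1)) * B <= e.
  rewrite (@le_trans _ _ (e / (B + 1) * B)) ?ler_wpM2r// ?ge_min ?lexx ?orbT//.
  by rewrite mulrAC ler_pdivrMr ?ltr_wpDl// ler_pM2l//; lra.
lra.
Qed.

End prox_existence.

Section subdifferential_theory.
Context {R : realType} {H : hilbertType R}.
Implicit Types (h : H -> \bar R) (p q u v z : H).

Lemma subdifferential_fin h p u : proper_ereal h -> subdifferential h p u ->
  h p = (fine (h p))%:E.
Proof.
move=> hp hu; have [z [a hz]] := proper_finite hp.
move: (hu z); rewrite hz; case: (h p) (hp.1 p) => [r //|_ |//].
by rewrite addye.
Qed.

(** The subgradient [v] guarantees that [h q] is finite, so that the inequality can be read in the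
    reals. *)
Lemma subdifferential_le h p q u v : proper_ereal h ->
  subdifferential h p u -> subdifferential h q v ->
  fine (h p) + inner u (q - p) <= fine (h q).
Proof.
move=> hp hu hv; have := hu q.
by rewrite (subdifferential_fin hp hu) (subdifferential_fin hp hv) -EFinD lee_fin.
Qed.

Lemma subdifferential_monotone h p q u v : proper_ereal h ->
  subdifferential h p u -> subdifferential h q v ->
  0 <= inner (u - v) (p - q).
Proof.
move=> hp hu hv.
have := subdifferential_le hp hu hv; have := subdifferential_le hp hv hu.
by rewrite !innerE; lra.
Qed.

End subdifferential_theory.

(** * Convex conjugates *)

Section conjugate_theory.
Context {R : realType} {H : hilbertType R}.
Variable h : H -> \bar R.
Hypotheses (hp : proper_ereal h) (hc : convex_ereal h)
  (hl : lower_semicontinuous h).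

Lemma conjugate_gtNy u : (-oo < conjugate h u)%E.
Proof.
have [y [r hy]] := proper_finite hp.
apply: (@lt_le_trans _ _ ((inner u y)%:E - h y)%E); first by rewrite hy ltNyr.
by apply: ereal_sup_ubound; exists y.
Qed.

(** The conjugate is finite at any subgradient of [h], where the supremum is attained at the base
    point; the prox supplies such a subgradient. *)
Lemma conjugate_proper : proper_ereal (conjugate h).
Proof.
split; first exact: conjugate_gtNy.
have := @proxP _ _ h 1 0 ltr01 hp hc hl.
set p := prox _ _ _; set v := _ *: _ => pv; exists v.
have hpE := subdifferential_fin hp pv.
apply: (@le_lt_trans _ _ (inner v p - fine (h p))%:E); last exact: ltry.
apply: ge_ereal_sup => _ [y _ <-]; have := pv y; rewrite hpE.
case: (h y) (hp.1 y) => [r _||//]; last by rewrite leNye.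
by rewrite -EFinB -EFinD !lee_fin innerDr innerNr; lra.
Qed.

Lemma conjugate_convex : convex_ereal (conjugate h).
Proof.
move=> u v t /andP[t0 t1]; apply: ge_ereal_sup => _ [y _ <-].
case hy : (h y) (hp.1 y) => [r||//] _; last by rewrite leNye.
have -> : ((inner (t *: u + (1 - t) *: v) y)%:E - r%:E =
    t%:E * ((inner u y)%:E - h y) + (1 - t)%:E * ((inner v y)%:E - h y))%E.
  rewrite hy -!EFinB -!EFinM -EFinD innerDl !innerZl.
  by congr (_%:E); ring.
have le_conj w : ((inner w y)%:E - h y <= conjugate h w)%E.
  by apply: ereal_sup_ubound; exists y.
by apply: leeD; apply: lee_wpmul2l; rewrite // lee_fin ?subr_ge0 ltW.
Qed.

Lemma conjugate_lsc : lower_semicontinuous (conjugate h).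
Proof.
move=> u a /ereal_sup_gt[_ [y _ <-]].
case hy : (h y) (hp.1 y) => [r||//] _ // au.
exists [set v | a + r < inner v y].
  apply: (cvgr_gt (inner u y)); first exact: inner_continuous.
  by move: au; rewrite -EFinB lte_fin; lra.
move=> v /= av; apply: (@lt_le_trans _ _ ((inner v y)%:E - h y)%E).
  by rewrite hy -EFinB lte_fin; lra.
by apply: ereal_sup_ubound; exists y.
Qed.

End conjugate_theory.

(** * Riesz representation and adjoints *)

Section riesz.
Context {R : realType} {H : hilbertType R}.

(* The representing vector is minus the prox of [- phi] at the origin: the
   optimality condition of that minimization is the representation formula. *)
Lemma riesz (phi : H -> R) (M : R) :
  (forall a x y, phi (a *: x + y) = a * phi x + phi y) ->
  (forall x, `|phi x| <= M * `|x|) -> exists u, forall x, phi x = inner x u.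
Proof.
move=> phil phiM; pose h x := (- phi x)%:E.
have phiD x y : phi (x + y) = phi x + phi y by rewrite -{1}[x]scale1r phil mul1r.
have phi0 : phi 0 = 0 by have := phiD 0 0; rewrite addr0; lra.
have phiZ a x : phi (a *: x) = a * phi x by rewrite -[a *: x]addr0 phil phi0 addr0.
have hp : proper_ereal h by split=> [x|]; [exact: ltNyr | exists 0; exact: ltry].
have hc : convex_ereal h.
  move=> x y t _; rewrite /h -!EFinM -EFinD lee_fin phil phiZ; lra.
have hl : lower_semicontinuous h.
  move=> x a; rewrite /h lte_fin => ax.
  have d0 : 0 < (- phi x - a) / (`|M| + 1) by apply: divr_gt0; [lra | rewrite ltr_wpDl].
  exists (ball x ((- phi x - a) / (`|M| + 1))); first exact: nbhsx_ballx.
  move=> y; rewrite -ball_normE /= distrC ltr_pdivlMr; last by rewrite ltr_wpDl.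
  move=> yx.
  have := phiD (y - x) x; rewrite subrK => phiy; rewrite lte_fin.
  have := ler_norm (phi (y - x)); have := phiM (y - x).
  have : M * `|y - x| <= `|M| * `|y - x| by rewrite ler_wpM2r// ler_norm.
  by have := normr_ge0 (y - x); lra.
have := @proxP _ _ h 1 0 ltr01 hp hc hl.
rewrite invr1 scale1r sub0r; set p := prox _ _ _ => hv; exists p => x.
have le z : phi z <= inner z p.
  have := hv (z + p); rewrite addrK /h -EFinD lee_fin phiD innerNl innerC; lra.
apply/eqP; rewrite eq_le le /=.
have := le (- x); rewrite innerNl -scaleN1r phiZ; lra.
Qed.

End riesz.

Section adjoint_theory.
Context {R : realType} {H G : hilbertType R} (L : {linear H -> G}).
Hypothesis Lb : bounded_operator L.

Lemma opnorm_le x : `|L x| <= opnorm L * `|x|.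
Proof.
have [->|x0] := eqVneq x 0; first by rewrite linear0 !normr0 mulr0.
have nx : 0 < `|x| by rewrite normr_gt0.
rewrite -ler_pdivrMr//; apply: ub_le_sup.
  have [M LM] := Lb; exists `|M| => _ [z /= z1 <-].
  apply: (le_trans (LM z)); apply: (@le_trans _ _ (`|M| * `|z|)).
    by rewrite ler_wpM2r// ler_norm.
  by rewrite -[leRHS]mulr1 ler_wpM2l.
exists (`|x|^-1 *: x); first by rewrite /= normrZ normfV normr_id mulVf ?gt_eqF.
by rewrite linearZ normrZ normfV normr_id mulrC.
Qed.

Lemma adjointE x y : inner (L x) y = inner x (adjoint L y).
Proof.
apply: (getPex (P := [set u : H | forall x, inner (L x) y = inner x u])).
apply: (@riesz _ _ _ (opnorm L * `|y|)) => [a u v|u].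
  by rewrite linearP innerDl innerZl.
rewrite (le_trans (cauchy_schwarz _ _))// mulrAC ler_wpM2r//.
exact: opnorm_le.
Qed.

Lemma adjointB y z : adjoint L (y - z) = adjoint L y - adjoint L z.
Proof.
by apply: inner_inj => x; rewrite innerDr innerNr -!adjointE innerDr innerNr.
Qed.

(** The bound |L^* y|^2 <= |L| |L^* y| |y| is closed by the arithmetic-geometric mean inequality,
    which avoids dividing by a norm that may vanish. *)
Lemma adjoint_sqr_le y :
  inner (adjoint L y) (adjoint L y) <= opnorm L ^+ 2 * inner y y.
Proof.
have : inner (adjoint L y) (adjoint L y) <= opnorm L * `|adjoint L y| * `|y|.
  rewrite -adjointE; apply: le_trans (ler_norm _) _.
  by apply: le_trans (cauchy_schwarz _ _) _; rewrite ler_wpM2r// opnorm_le.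
rewrite !inner_normE; have := sqr_ge0 (`|adjoint L y| - opnorm L * `|y|); lra.
Qed.

Lemma norm_adjoint_le y : `|adjoint L y| <= `|opnorm L| * `|y|.
Proof.
rewrite -(@ler_pXn2r _ 2) ?nnegrE ?mulr_ge0// exprMn real_normK ?num_real//.
by rewrite -!inner_normE adjoint_sqr_le.
Qed.

End adjoint_theory.

(** * Energy of the Chambolle-Pock iteration *)

Section energy.
Context {R : realType} {H G : hilbertType R} (L : {linear H -> G}).
Hypothesis Lb : bounded_operator L.
Variables tau sigma theta : R.
Hypotheses (tau_gt0 : 0 < tau) (sigma_gt0 : 0 < sigma).
Local Notation "L^*" := (adjoint L).

(** The first three terms are half the squared length in the usual preconditioner metric of the
    method. That form may be indefinite here, as tau sigma |L|^2 may exceed 1 when theta < 3/2. *)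
Definition energy (x : H) (y : G) (w : H) (F : R) : R :=
  (2 * tau)^-1 * inner x x + (2 * sigma)^-1 * inner y y - inner (L x) y
  + (theta - 1) * F + tau / 4 * inner w w.

(* The sum-of-squares certificate of the descent; the step-size condition makes
   the last bracket coercive in [b]. *)
Definition dissipation (a : H) (b : G) (w w' : H) : R :=
  tau / 4 * inner (w - tau^-1 *: a) (w - tau^-1 *: a)
  + (2 * theta - 1) * tau / 8 * inner (tau^-1 *: a + w') (tau^-1 *: a + w')
  + ((2 * sigma)^-1 * inner b b
     - (1 + 2 * theta) * tau / 8 * inner (L^* b) (L^* b)).

(** The purely algebraic part of the descent. Here [x], [y] are the current iterates relative to a
    KKT point, [a], [b] the next increments and [a_], [b_] the previous ones; [u], [u'], [v'] are
    the prox subgradients minus those of the KKT point. *)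
Lemma energy_identity (x a a_ : H) (y b b_ : G) (F F' : R) :
  let w' := tau^-1 *: a - L^* b in
  let w := tau^-1 *: a_ - L^* b_ in
  let u' := - (tau^-1 *: a) - L^* y in
  let u := - (tau^-1 *: a_) - L^* (y - b_) in
  let v' := - (sigma^-1 *: b) + L (x + a + theta *: a) in
  energy (x + a) (y + b) w' F' - energy x y w F + dissipation a b w w' =
  - inner u' (x + a) - inner v' (y + b) - (theta - 1 / 2) * inner u' a
  + 1 / 2 * inner u a + (theta - 1) * (F' - F).
Proof.
rewrite /= /energy /dissipation !(adjointB Lb).
rewrite !innerE !(adjointE Lb) !innerE.
move: (L^* y) (L^* b) (L^* b_) => p q q_.
(* [field] does not know that [inner] is symmetric, so each pair is brought to one order. *)
rewrite ?(innerC a x) ?(innerC a_ a) ?(innerC p x) ?(innerC p a) ?(innerC q x).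
rewrite ?(innerC q a) ?(innerC q_ a) ?(innerC q a_) ?(innerC q_ a_) ?(innerC b y).
rewrite ?(innerC q_ q).
by field; rewrite !gt_eqF.
Qed.

(** The four inequalities are added with weights 1, 1, theta - 1/2 and 1/2. The coefficient theta -
    1 of [F] in the energy is the one for which all multiples of [F' - F] cancel. *)
Lemma energy_descent (x a a_ : H) (y b b_ : G) (F F' G' : R) :
  let w' := tau^-1 *: a - L^* b in
  let w := tau^-1 *: a_ - L^* b_ in
  let u' := - (tau^-1 *: a) - L^* y in
  let u := - (tau^-1 *: a_) - L^* (y - b_) in
  let v' := - (sigma^-1 *: b) + L (x + a + theta *: a) in
  1 / 2 < theta ->
  F' <= inner u' (x + a) -> G' <= inner v' (y + b) ->
  F' - F <= inner u' a -> inner u a <= F' - F ->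
  energy (x + a) (y + b) w' F' + dissipation a b w w' + F' + G' <=
  energy x y w F.
Proof.
move=> w' w u' u v' theta_gt hF' hG' hu' hu.
have := energy_identity x a a_ y b b_ F F'.
rewrite /= -/w' -/w -/u' -/u -/v' => eqE.
have : (theta - 1 / 2) * (F' - F) <= (theta - 1 / 2) * inner u' a.
  by rewrite ler_wpM2l//; lra.
lra.
Qed.

(* Half of the coupling term [- inner (L x) y] is bounded below through the
   subgradient inequality [F <= inner u x]; the other half is kept. *)
Lemma energy_lower_bound (x a_ : H) (y b_ : G) (F : R) :
  let w := tau^-1 *: a_ - L^* b_ in
  let u := - (tau^-1 *: a_) - L^* (y - b_) in
  1 / 2 < theta -> 0 <= F -> F <= inner u x ->
  (4 * tau)^-1 * inner (x - tau *: L^* y) (x - tau *: L^* y)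
  + ((2 * sigma)^-1 * inner y y - tau / 4 * inner (L^* y) (L^* y)) <=
  energy x y w F.
Proof.
move=> w u theta_gt F0 hF.
have tF : 0 <= (theta - 1 / 2) * F by rewrite mulr_ge0//; lra.
have : 0 <= tau / 4 * inner (w + tau^-1 *: x) (w + tau^-1 *: x).
  by rewrite mulr_ge0 ?inner_ge0 ?divr_ge0 ?ltW.
(* Since u = - w - L^* y, the cross term <w, x> equals - <u, x> - <L x, y>, which accounts for half
   of the coupling. Using [F <= inner u x] then leaves [F] with the coefficient theta - 1/2. *)
have -> : tau / 4 * inner (w + tau^-1 *: x) (w + tau^-1 *: x) =
  energy x y w F - ((4 * tau)^-1 * inner (x - tau *: L^* y) (x - tau *: L^* y)
   + ((2 * sigma)^-1 * inner y y - tau / 4 * inner (L^* y) (L^* y)))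
  - (theta - 1) * F - 1 / 2 * inner u x.
  rewrite /energy {}/w {hF}/u !(adjointB Lb).
  rewrite !innerE !(adjointE Lb).
  move: (L^* y) (L^* b_) => p q_.
  rewrite ?(innerC a_ x) ?(innerC p x) ?(innerC q_ x) ?(innerC q_ a_).
  by field; rewrite !gt_eqF.
lra.
Qed.

End energy.

(** * Weak limits along ultrafilters *)

Section ultrafilter_limits.
Context {R : realType}.

(** If the preimage of a neighbourhood were not in [F], then [F] restricted to its complement would
    be proper and would extend to an ultrafilter violating the hypothesis. *)
Lemma cvg_ultraP (T : Type) (S : topologicalType) (F : set_system T)
    {FF : Filter F} (s : T -> S) (l : S) :
  (forall U, UltraFilter U -> F `<=` U -> s @ U --> l) -> s @ F --> l.
Proof.
move=> h V Vl; change (F (s @^-1` V)); apply: contrapT => FV.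
have WP : ProperFilter (within (~` (s @^-1` V)) F).
  split; last exact: within_filter.
  move=> W; apply: FV; apply: (@filterS _ F FF _ _ _ W) => t /= W'; exact: contrapT.
have [U [UU WU]] := ultraFilterLemma WP.
have FU : F `<=` U by move=> B FB; apply: WU; exact: filterS FB.
have UV : U (s @^-1` V) by exact: h.
have UnV : U (~` (s @^-1` V)) by apply: WU; exact: withinT.
by have /filter_ex[t []] : U (s @^-1` V `&` ~` (s @^-1` V)) by exact: filterI.
Qed.

Lemma ultra_bounded_cvg (T : Type) (U : set_system T) (s : T -> R^o) (M : R) :
  UltraFilter U -> (\forall t \near U, `|s t| <= M) ->
  exists l : R^o, s @ U --> l.
Proof.
move=> UU sM; have : (s @ U) `[- M, M]%classic.
  by apply: filterS sM => t; rewrite /= in_itv /= ler_norml.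
move=> /(@segment_compact _ _ _)[l [_ cl]]; exists l => V Vl.
rewrite /= nbhs_filterE; have [//|UV] := in_ultra_setVsetC (s @^-1` V) UU.
by have [t []] := cl (~` V) V UV Vl.
Qed.

(** The limits of [inner (z t) h] form a bounded linear functional of [h], which Riesz
    represents. *)
Lemma ultra_weak_cvg (H : hilbertType R) (T : Type) (U : set_system T)
    (z : T -> H) (M : R) :
  UltraFilter U -> (\forall t \near U, `|z t| <= M) ->
  exists z0, forall h, (inner (z t) h : R^o) @[t --> U] --> (inner z0 h : R^o).
Proof.
move=> UU zM.
have cv h : exists l : R^o, (inner (z t) h : R^o) @[t --> U] --> l.
  apply: (@ultra_bounded_cvg _ _ _ (M * `|h|)); apply: filterS zM => t zt.
  by rewrite (le_trans (cauchy_schwarz _ _))// ler_wpM2r.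
pose phi h := sval (cid (cv h)).
have phiE h : (inner (z t) h : R^o) @[t --> U] --> (phi h : R^o).
  by rewrite /phi; case: cid.
have lin a u v : phi (a *: u + v) = a * phi u + phi v.
  apply: (cvg_unique (@norm_hausdorff _ _) (phiE (a *: u + v))).
  have -> : (fun t => inner (z t) (a *: u + v)) =
      (fun t => a * inner (z t) u + inner (z t) v).
    by apply/funext => t; rewrite innerDr innerZr.
  by apply: cvgD; [apply: cvgMr; exact: phiE | exact: phiE].
have phiM h : `|phi h| <= M * `|h|.
  apply: (cvgr_to_le (cvg_norm (phiE h))); apply: filterS zM => t zt.
  by rewrite (le_trans (cauchy_schwarz _ _))// ler_wpM2r.
have [z0 z0E] := riesz lin phiM.
by exists z0 => h; rewrite innerC -z0E.
Qed.

End ultrafilter_limits.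

Section inner_limits.
Context {R : realType} {H : hilbertType R}.
Implicit Types v z : nat -> H.

Lemma cvg0_sqr_inner v (e : nat -> R^o) (k : R) : 0 < k ->
  (forall n, k * inner (v n) (v n) <= e n) -> e @ \oo --> (0 : R^o) ->
  v @ \oo --> (0 : H).
Proof.
move=> k0 ve /cvgrPdist_lt e0; apply/cvgrPdist_lt => d d0.
have kd0 : 0 < k * d ^+ 2 by rewrite mulr_gt0// exprn_gt0.
apply: filterS (e0 _ kd0) => n; rewrite !sub0r !normrN => en.
rewrite -(@ltr_pXn2r _ 2) ?nnegrE ?(ltW d0)// -(ltr_pM2l k0).
rewrite -inner_normE (le_lt_trans (ve n))//.
by rewrite (le_lt_trans (ler_norm _)).
Qed.

Lemma cvg0_inner v z (M : R) : v @ \oo --> (0 : H) -> (forall n, `|z n| <= M) ->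
  (inner (v n) (z n) : R^o) @[n --> \oo] --> (0 : R^o).
Proof.
move=> /cvgrPdist_lt v0 zM; apply/cvgrPdist_lt => d d0.
have M0 : 0 <= M by apply: le_trans (zM 0%N).
have dM : 0 < d / (M + 1) by rewrite divr_gt0// ltr_wpDl.
apply: filterS (v0 _ dM) => n; rewrite !sub0r !normrN ltr_pdivlMr ?ltr_wpDl//.
move=> vn; apply: le_lt_trans vn; apply: (le_trans (cauchy_schwarz _ _)).
by rewrite ler_wpM2l// (le_trans (zM n))// lerDl.
Qed.

End inner_limits.

(** * Convergence *)

Section tilt.
Context {R : realType} {H : hilbertType R}.
Variables (h : H -> \bar R) (p c : H).
Hypotheses (hp : proper_ereal h) (pc : subdifferential h p c).

(* The Bregman distance to [p] induced by the subgradient [c]. *)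
Definition tilt (q : H) : R := fine (h q) - fine (h p) - inner c (q - p).

Lemma tilt_le q r u u' : subdifferential h q u -> subdifferential h r u' ->
  inner (u - c) (r - q) <= tilt r - tilt q.
Proof.
move=> qu ru; have := subdifferential_le hp qu ru.
by rewrite /tilt !innerE; lra.
Qed.

Lemma tilt_base : tilt p = 0.
Proof. by rewrite /tilt !subrr inner0r subr0. Qed.

Lemma tilt_ge0 q u : subdifferential h q u -> 0 <= tilt q.
Proof. by move=> qu; have := subdifferential_le hp pc qu; rewrite /tilt; lra. Qed.

Lemma tilt_le_inner q u : subdifferential h q u ->
  tilt q <= inner (u - c) (q - p).
Proof.
by move=> qu; have := tilt_le qu pc; rewrite tilt_base -(opprB q p) innerNr; lra.
Qed.

End tilt.

Section saddle_points.
Context {R : realType} {H G : hilbertType R} (L : {linear H -> G}).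
Variables (f : H -> \bar R) (h : G -> \bar R).

(** [KKT_point] with [conjugate g] abstracted to any [h], so that the primal and dual sides are
    treated alike; for [h := conjugate g] the two unfold to the same statement. *)
Definition saddle_point (p : H * G) : Prop :=
  subdifferential f p.1 (- adjoint L p.2) /\ subdifferential h p.2 (L p.1).

Hypothesis (Lb : bounded_operator L).
Hypotheses (fp : proper_ereal f) (fc : convex_ereal f)
  (fl : lower_semicontinuous f).
Hypotheses (hp : proper_ereal h) (hc : convex_ereal h)
  (hl : lower_semicontinuous h).

(* Minty's trick: test the monotonicity inequality at the resolvents of
   [x - adjoint L y] and [y + L x]; the skew coupling terms cancel. *)
Lemma minty_saddle (x : H) (y : G) :
  (forall p u q v, subdifferential f p u -> subdifferential h q v ->
     0 <= inner (- adjoint L y - u) (x - p) + inner (L x - v) (y - q)) ->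
  saddle_point (x, y).
Proof.
have pu := @proxP _ _ f 1 (x - adjoint L y) ltr01 fp fc fl.
have qv := @proxP _ _ h 1 (y + L x) ltr01 hp hc hl.
move: pu qv; set p := prox _ _ _; set q := prox _ _ _; rewrite invr1 !scale1r.
move=> pu qv /(_ _ _ _ _ pu qv).
have -> : - adjoint L y - (x - adjoint L y - p) = - (x - p).
  by rewrite !opprB addrCA addKr.
have -> : L x - (y + L x - q) = - (y - q).
  by rewrite !opprB opprD addrCA (addrC (- y)) addNKr.
rewrite !innerNl => le0.
have x0 := inner_ge0 (x - p); have y0 := inner_ge0 (y - q).
have xp : x = p.
  apply/eqP; rewrite -subr_eq0 -normr_eq0 -sqrf_eq0 -inner_normE.
  by rewrite eq_le inner_ge0 andbT; lra.
have yq : y = q.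
  apply/eqP; rewrite -subr_eq0 -normr_eq0 -sqrf_eq0 -inner_normE.
  by rewrite eq_le inner_ge0 andbT; lra.
split=> /=.
  by move: pu; rewrite -xp addrAC subrr add0r.
by move: qv; rewrite -yq addrAC subrr add0r.
Qed.

End saddle_points.

Section chambolle_pock_convergence.
Context {R : realType} {H G : hilbertType R} (L : {linear H -> G}).
Variables (f : H -> \bar R) (h : G -> \bar R) (tau sigma theta : R).
Variables (x : nat -> H) (y : nat -> G).
Hypotheses (Lb : bounded_operator L).
Hypotheses (fp : proper_ereal f) (hp : proper_ereal h).
Hypotheses (theta_gt : 1 / 2 < theta) (tau_gt0 : 0 < tau) (sigma_gt0 : 0 < sigma).
Hypothesis step_lt : tau * sigma * opnorm L ^+ 2 < 4 / (1 + 2 * theta).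
Local Notation "L^*" := (adjoint L).

Let a n := x n.+1 - x n.
Let b n := y n.+1 - y n.
Let u n := - (tau^-1 *: a n) - L^* (y n).
Let v n := - (sigma^-1 *: b n) + L (x n.+1 + theta *: a n).
Let w n := tau^-1 *: a n - L^* (b n).

Hypothesis xu : forall n, subdifferential f (x n.+1) (u n).
Hypothesis yv : forall n, subdifferential h (y n.+1) (v n).

(** The one place where the step-size condition is opened: multiplied by (1 + 2 theta) / (8 sigma),
    it says that the witness is positive. *)
Lemma step_slack : exists2 d, 0 < d & forall b0 : G,
  d * inner b0 b0 <= (2 * sigma)^-1 * inner b0 b0
    - (1 + 2 * theta) * tau / 8 * inner (L^* b0) (L^* b0).
Proof.
have [tg t0 s0] := And3 theta_gt tau_gt0 sigma_gt0.
exists ((2 * sigma)^-1 - (1 + 2 * theta) * tau / 8 * opnorm L ^+ 2).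
  move: step_lt; rewrite ltr_pdivlMr; last lra.
  move=> lt4; rewrite subr_gt0 -(ltr_pM2r (_ : 0 < 2 * sigma)); last lra.
  rewrite mulVf; last lra.
  lra.
move=> b0; have k0 : 0 <= (1 + 2 * theta) * tau / 8.
  by rewrite divr_ge0// mulr_ge0//; lra.
by have := ler_wpM2l k0 (adjoint_sqr_le Lb b0); lra.
Qed.

(** * Energy decrease along the iterates relative to a KKT point *)

Section fejer.
Variable p : H * G.
Hypothesis p_saddle : saddle_point L f h p.

Let F n := tilt f p.1 (- L^* p.2) (x n).
(** The index starts at iterate 1: [x 0] is arbitrary, so [f] may be infinite there, and [w n] needs
    a previous increment. *)
Let E n := energy L tau sigma theta (x n.+1 - p.1) (y n.+1 - p.2) (w n) (F n.+1).
Let D n := dissipation L tau sigma theta (a n.+1) (b n.+1) (w n) (w n.+1).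

Let F_ge0 n : 0 <= F n.+1.
Proof. exact: (tilt_ge0 fp p_saddle.1 (xu n)). Qed.

Let shift_u n : u n - (- L^* p.2) = - (tau^-1 *: a n) - L^* (y n - p.2).
Proof. by rewrite (adjointB Lb) opprB opprK addrA addrAC. Qed.

Let shift_x n : x n - p.1 + a n = x n.+1 - p.1.
Proof. by rewrite /a addrC subrKA. Qed.

Let shift_v n : v n - L p.1 =
  - (sigma^-1 *: b n) + L (x n - p.1 + a n + theta *: a n).
Proof. by rewrite shift_x /v -addrA -linearB /= addrAC. Qed.

Let shift_y n : y n - p.2 + b n = y n.+1 - p.2.
Proof. by rewrite /b addrC subrKA. Qed.

Let shift_y_ n : y n.+1 - p.2 - b n = y n - p.2.
Proof. by rewrite -shift_y addrK. Qed.

(** The nonnegative dual gap is dropped, but the primal gap [F n.+2] is kept: its convergence to 0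
    is needed to remove the [F] term from the energy. *)
Let energy_step n : E n.+1 + D n + F n.+2 <= E n.
Proof.
have [pu pv] := p_saddle.
have Gy := tilt_ge0 hp pv (yv n.+1).
have := @energy_descent _ _ _ L Lb tau sigma theta tau_gt0 sigma_gt0
  (x n.+1 - p.1) (a n.+1) (a n) (y n.+1 - p.2) (b n.+1) (b n)
  (F n.+1) (F n.+2) (tilt h p.2 (L p.1) (y n.+2)) theta_gt.
rewrite /= -shift_v shift_y_ -!shift_u shift_x shift_y.
move=> /(_ (tilt_le_inner fp pu (xu n.+1)) (tilt_le_inner hp pv (yv n.+1))).
have := tilt_le p.1 (- L^* p.2) fp (xu n) (xu n.+1).
have := tilt_le p.1 (- L^* p.2) fp (xu n.+1) (xu n).
rewrite -/(F _) -/(F _) -(opprB (x n.+2)) innerNr => le1 le2.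
move=> /(_ _ le2); rewrite -/(a n.+1) -/(w n) -/(w n.+1) -/(D n) -/(E n) -/(E n.+1).
have le1' : F n.+2 - F n.+1 <= inner (u n.+1 - - L^* p.2) (a n.+1)
  by rewrite /a; lra.
by move=> /(_ le1'); lra.
Qed.

Let energy_ge : exists2 d, 0 < d & forall n,
  (4 * tau)^-1 * inner (x n.+1 - p.1 - tau *: L^* (y n.+1 - p.2))
                       (x n.+1 - p.1 - tau *: L^* (y n.+1 - p.2))
  + d * inner (y n.+1 - p.2) (y n.+1 - p.2) <= E n.
Proof.
have [d d0 slack] := step_slack; exists d => // n.
have := @energy_lower_bound _ _ _ L Lb tau sigma theta tau_gt0 sigma_gt0
  (x n.+1 - p.1) (a n) (y n.+1 - p.2) (b n) (F n.+1) theta_gt (F_ge0 n).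
rewrite /= shift_y_ -shift_u => /(_ (tilt_le_inner fp p_saddle.1 (xu n))).
apply: le_trans; rewrite lerD2l; apply: le_trans (slack _) _; rewrite lerD2l.
rewrite lerN2 ler_wpM2r ?inner_ge0//.
(* As theta > 1/2, the coefficient tau/4 is at most (1 + 2 theta) tau / 8, so [step_slack] covers
   this bracket as well. *)
have : tau * (1 / 2) <= tau * theta by rewrite ler_wpM2l// ltW.
by have t0 := tau_gt0; lra.
Qed.

Let dissipation_ge : exists2 d, 0 < d & forall n,
  tau / 4 * inner (w n - tau^-1 *: a n.+1) (w n - tau^-1 *: a n.+1)
  + (2 * theta - 1) * tau / 8 *
    inner (tau^-1 *: a n.+1 + w n.+1) (tau^-1 *: a n.+1 + w n.+1)
  + d * inner (b n.+1) (b n.+1) <= D n.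
Proof.
have [d d0 slack] := step_slack; exists d => // n.
by rewrite /D /dissipation lerD2l.
Qed.

Let energy_ge0 n : 0 <= E n.
Proof.
have [d d0 /(_ n)] := energy_ge; apply: le_trans.
by apply: addr_ge0; apply: mulr_ge0; rewrite ?inner_ge0 ?invr_ge0 ?mulr_ge0 ?ltW.
Qed.

Let D_ge0 n : 0 <= D n.
Proof.
have [d d0 /(_ n)] := dissipation_ge; apply: le_trans.
have t2 : 0 <= 2 * theta - 1 by have tg := theta_gt; lra.
have t0 := ltW tau_gt0.
apply: addr_ge0; last by rewrite mulr_ge0 ?inner_ge0 ?ltW.
by apply: addr_ge0; rewrite mulr_ge0 ?inner_ge0 ?divr_ge0 ?mulr_ge0.
Qed.

Let E_cvg : cvgn E.
Proof.
apply: nonincreasing_is_cvgn.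
  apply/nonincreasing_seqP => n; have := energy_step n.
  have := D_ge0 n; have := F_ge0 n.+1; lra.
by exists 0 => _ [n _ <-].
Qed.

Let DF_cvg0 : (fun n => D n + F n.+2) @ \oo --> (0 : R).
Proof.
apply: (@squeeze_cvgr _ _ _ _ (fun=> 0) (fun n => E n - E n.+1)).
- near=> n; have := energy_step n; have := D_ge0 n; have := F_ge0 n.+1.
  by move=> ? ? ?; apply/andP; split; lra.
- exact: cvg_cst.
- rewrite -(subrr (limn E)); apply: cvgB; first exact: E_cvg.
  by rewrite cvg_shiftS; exact: E_cvg.
Unshelve. all: by end_near. Qed.

Let sqr_bound (V : hilbertType R) (z : V) : `|z| <= 1 + inner z z.
Proof. by rewrite inner_normE; have := sqr_ge0 (`|z| - 1 / 2); lra. Qed.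

Lemma cp_bounded : exists M, forall n, `|x n.+1| <= M /\ `|y n.+1| <= M.
Proof.
have [d d0 Ege] := energy_ge.
have E_le n : E n <= E 0%N.
  elim: n => // n; apply: le_trans; have := energy_step n.
  by have := D_ge0 n; have := F_ge0 n.+1; lra.
pose K := opnorm L ^+ 2; pose C := E 0%N / d.
have t0 := tau_gt0.
(* With X = Z + tau L^* Y, the terms bound |Z|, tau |L^* Y| and |Y| through [sqr_bound], plus the
   norms of the KKT point. *)
exists ((1 + 4 * tau * E 0%N) + tau * (1 + K * C) + `|p.1| + (1 + C + `|p.2|)) => n.
set X := x n.+1 - p.1; set Y := y n.+1 - p.2; set Z := X - tau *: L^* Y.
have := le_trans (Ege n) (E_le n); rewrite -/X -/Y -/Z => ZY.
have ZZ := inner_ge0 Z; have YY := inner_ge0 Y.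
have k0 : 0 < (4 * tau)^-1 by rewrite invr_gt0; lra.
have kZ : 0 <= (4 * tau)^-1 * inner Z Z by rewrite mulr_ge0// ltW.
have dY : 0 <= d * inner Y Y by rewrite mulr_ge0// ltW.
have YC : inner Y Y <= C by rewrite /C ler_pdivlMr//; lra.
have ZC : inner Z Z <= 4 * tau * E 0%N by rewrite -ler_pdivrMl; lra.
have LC : inner (L^* Y) (L^* Y) <= K * C.
  by rewrite (le_trans (adjoint_sqr_le Lb Y))// ler_wpM2l// sqr_ge0.
have nY : `|y n.+1| <= 1 + C + `|p.2|.
  rewrite -(subrK p.2 (y n.+1)) -/Y (le_trans (ler_normD _ _))// lerD2r.
  by have := sqr_bound Y; lra.
have nX : `|x n.+1| <= (1 + 4 * tau * E 0%N) + tau * (1 + K * C) + `|p.1|.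
  rewrite -(subrK p.1 (x n.+1)) -/X (le_trans (ler_normD _ _))// lerD2r.
  rewrite -(subrK (tau *: L^* Y) X) -/Z (le_trans (ler_normD _ _))// lerD//.
    by have := sqr_bound Z; lra.
  rewrite normrZ gtr0_norm// ler_wpM2l//; first lra.
  by have := sqr_bound (L^* Y); lra.
by have := normr_ge0 (x n.+1); have := normr_ge0 (y n.+1); split; lra.
Qed.

Let F_cvg0 : (fun n => F n.+1) @ \oo --> (0 : R).
Proof.
rewrite -cvg_shiftS; apply: (squeeze_cvgr _ (@cvg_cst _ _ _ _ _) DF_cvg0).
by near=> n => /=; rewrite F_ge0 lerDr D_ge0.
Unshelve. all: by end_near. Qed.

Let c n := tau^-1 *: a n.+1 + w n.+1.

Let DF_ge d : (forall n, tau / 4 * inner (w n - tau^-1 *: a n.+1)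
      (w n - tau^-1 *: a n.+1) + (2 * theta - 1) * tau / 8 * inner (c n) (c n)
    + d * inner (b n.+1) (b n.+1) <= D n) -> 0 < d ->
  forall n, (2 * theta - 1) * tau / 8 * inner (c n) (c n) <= D n + F n.+2 /\
            d * inner (b n.+1) (b n.+1) <= D n + F n.+2.
Proof.
move=> Dge d0 n; have := Dge n; have := F_ge0 n.+1.
have t0 := tau_gt0; have tg := theta_gt.
have : 0 <= tau / 4 * inner (w n - tau^-1 *: a n.+1) (w n - tau^-1 *: a n.+1).
  by rewrite mulr_ge0 ?inner_ge0// divr_ge0 ?ltW.
have : 0 <= (2 * theta - 1) * tau / 8 * inner (c n) (c n).
  by rewrite mulr_ge0 ?inner_ge0// divr_ge0// mulr_ge0 ?(ltW t0)//; lra.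
have : 0 <= d * inner (b n.+1) (b n.+1) by rewrite mulr_ge0 ?inner_ge0 ?ltW.
lra.
Qed.

Lemma cp_increment_y : b @ \oo --> (0 : G).
Proof.
have [d d0 Dge] := dissipation_ge.
rewrite -cvg_shiftS; apply: (cvg0_sqr_inner d0 _ DF_cvg0) => n.
exact: (DF_ge Dge d0 n).2.
Qed.

Let Lb_cvg0 : (fun n => L^* (b n.+1)) @ \oo --> (0 : H).
Proof.
have [d d0 Dge] := dissipation_ge.
have K1 : 0 < opnorm L ^+ 2 + 1 by rewrite ltr_wpDl// sqr_ge0.
apply: (cvg0_sqr_inner (divr_gt0 d0 K1) _ DF_cvg0) => n.
apply: le_trans (DF_ge Dge d0 n).2.
rewrite mulrAC ler_pdivrMr// -mulrA ler_wpM2l ?(ltW d0)//.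
have := adjoint_sqr_le Lb (b n.+1); have := inner_ge0 (b n.+1); lra.
Qed.

Let c_cvg0 : c @ \oo --> (0 : H).
Proof.
have [d d0 Dge] := dissipation_ge.
have k0 : 0 < (2 * theta - 1) * tau / 8.
  by rewrite divr_gt0// mulr_gt0//; have := theta_gt; lra.
apply: (cvg0_sqr_inner k0 _ DF_cvg0) => n.
exact: (DF_ge Dge d0 n).1.
Qed.

Lemma cp_increment_x : a @ \oo --> (0 : H).
Proof.
rewrite -cvg_shiftS /=.
(* By definition [c n] is 2/tau times [a n.+1] minus L^* [b n.+1]; both [c] and the adjoint term
   tend to 0. *)
have -> : (fun n => a n.+1) = (fun n => (tau / 2) *: (c n + L^* (b n.+1))).
  apply/funext => n; rewrite /c /w addrA subrK -scalerDl scalerA.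
  by rewrite -[LHS]scale1r; congr (_ *: _); field; rewrite gt_eqF.
have : (fun n => (tau / 2) *: (c n + L^* (b n.+1))) @ \oo -->
    (tau / 2) *: (0 + 0 : H).
  by apply: cvgZr; exact: (cvgD c_cvg0 Lb_cvg0).
by rewrite addr0 scaler0.
Qed.

Let w_cvg0 : w @ \oo --> (0 : H).
Proof.
rewrite -cvg_shiftS /=.
have -> : (fun n => w n.+1) = (fun n => c n - tau^-1 *: a n.+1).
  by apply/funext => n; rewrite /c addrC addKr.
have : (fun n => c n - tau^-1 *: a n.+1) @ \oo --> (0 - tau^-1 *: 0 : H).
  apply: cvgB; first exact: c_cvg0.
  by apply: cvgZr; rewrite (cvg_shiftS a); exact: cp_increment_x.
by rewrite scaler0 subr0.
Qed.

(** This is the energy minus its vanishing terms. What remains has the same quadratic part for every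
    KKT point, as the Opial argument requires. *)
Lemma cp_merit_cvg : cvgn (fun n => (2 * tau)^-1 * inner (x n.+1 - p.1) (x n.+1 - p.1)
  + (2 * sigma)^-1 * inner (y n.+1 - p.2) (y n.+1 - p.2)
  - inner (L (x n.+1 - p.1)) (y n.+1 - p.2)).
Proof.
have ww : (fun n => tau / 4 * (`|w n| * `|w n|)) @ \oo -->
    tau / 4 * (`|0 : H| * `|0 : H|).
  by apply: cvgMr; apply: cvgM; apply: (cvg_norm w_cvg0).
have FF : (fun n => (theta - 1) * F n.+1) @ \oo --> (theta - 1) * 0.
  exact: cvgMr F_cvg0.
have -> : (fun n => (2 * tau)^-1 * inner (x n.+1 - p.1) (x n.+1 - p.1)
  + (2 * sigma)^-1 * inner (y n.+1 - p.2) (y n.+1 - p.2)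
  - inner (L (x n.+1 - p.1)) (y n.+1 - p.2)) =
  (fun n => E n - (theta - 1) * F n.+1 - tau / 4 * (`|w n| * `|w n|)).
  by apply/funext => n; rewrite /E /energy (inner_normE (w n)); ring.
apply: (@cvgP _ _ (limn E - (theta - 1) * 0 - tau / 4 * (`|0 : H| * `|0 : H|))).
by apply: cvgB ww; apply: cvgB FF; exact: E_cvg.
Qed.

End fejer.

(** * Weak cluster points are saddle points *)

Section weak_cluster.
Hypotheses (fc : convex_ereal f) (fl : lower_semicontinuous f).
Hypotheses (hc : convex_ereal h) (hl : lower_semicontinuous h).

(** The coupling products of [X] and [Y] cancel by skewness. The first group is thus affine in
    [(X, Y)] and passes to weak limits; every other term contains an increment, which tends to 0
    strongly against a bounded factor. *)
Let cluster_identity (X a0 p u0 : H) (Y b0 q v0 : G) :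
  inner (- (tau^-1 *: a0) - L^* (Y - b0) - u0) (X - p) +
  inner (- (sigma^-1 *: b0) + L (X + theta *: a0) - v0) (Y - q) =
  (inner Y (L p) - inner X (L^* q) - (inner X u0 - inner p u0)
    - (inner Y v0 - inner q v0)) +
  (- tau^-1 * inner a0 (X - p) + inner b0 (L (X - p))
    - sigma^-1 * inner b0 (Y - q) + theta * inner a0 (L^* (Y - q))).
Proof.
rewrite (innerC Y (L p)) (innerC b0 (L _)) !(adjointB Lb) !innerE !(adjointE Lb).
rewrite !innerE (innerC u0 X) (innerC u0 p) (innerC v0 Y) (innerC v0 q).
rewrite !(innerC (L^* _)).
by ring.
Qed.

Lemma cp_weak_cluster (U : set_system nat) (M : R) (x0 : H) (y0 : G) :
  ProperFilter U -> \oo `<=` U ->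
  (forall n, `|x n.+1| <= M /\ `|y n.+1| <= M) ->
  a @ \oo --> (0 : H) -> b @ \oo --> (0 : G) ->
  (forall z, inner (x n.+1) z @[n --> U] --> inner x0 z) ->
  (forall z, inner (y n.+1) z @[n --> U] --> inner y0 z) ->
  saddle_point L f h (x0, y0).
Proof.
move=> UF ooU xyM a0 b0 xU yU; apply: minty_saddle => // p u0 q v0 pu qv.
pose T (x' : H) (y' : G) :=
  inner y' (L p) - inner x' (L^* q) - (inner x' u0 - inner p u0)
    - (inner y' v0 - inner q v0).
pose err n := - tau^-1 * inner (a n) (x n.+1 - p)
  + inner (b n) (L (x n.+1 - p)) - sigma^-1 * inner (b n) (y n.+1 - q)
  + theta * inner (a n) (L^* (y n.+1 - q)).
have T_err n : 0 <= T (x n.+1) (y n.+1) + err n.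
  rewrite /T /err -cluster_identity /b subKr.
  exact: addr_ge0 (subdifferential_monotone fp (xu n) pu)
                  (subdifferential_monotone hp (yv n) qv).
have errT : err @ U --> (0 : R).
  apply: (cvg_trans (cvg_app err ooU)).
  have xpM n : `|x n.+1 - p| <= M + `|p|.
    by rewrite (le_trans (ler_normB _ _))// lerD2r (xyM n).1.
  have yqM n : `|y n.+1 - q| <= M + `|q|.
    by rewrite (le_trans (ler_normB _ _))// lerD2r (xyM n).2.
  have LxM n : `|L (x n.+1 - p)| <= `|opnorm L| * (M + `|p|).
    apply: (le_trans (opnorm_le Lb _)).
    by apply: (le_trans (ler_norm _)); rewrite normrM normr_id ler_wpM2l.
  have LyM n : `|L^* (y n.+1 - q)| <= `|opnorm L| * (M + `|q|).
    by rewrite (le_trans (norm_adjoint_le Lb _))// ler_wpM2l.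
  have -> : (0 : R) = - tau^-1 * 0 + 0 - sigma^-1 * 0 + theta * 0.
    by rewrite !mulr0 subr0 !addr0.
  apply: cvgD; last by apply: cvgMr; exact: cvg0_inner a0 LyM.
  apply: cvgB; last by apply: cvgMr; exact: cvg0_inner b0 yqM.
  apply: cvgD; last exact: cvg0_inner b0 LxM.
  by apply: cvgMr; exact: cvg0_inner a0 xpM.
have TU : T (x n.+1) (y n.+1) + err n @[n --> U] --> T x0 y0 + 0.
  apply: cvgD errT; rewrite /T.
  apply: cvgB; last by apply: cvgB; [exact: yU | exact: cvg_cst].
  apply: cvgB; last by apply: cvgB; [exact: xU | exact: cvg_cst].
  by apply: cvgB; [exact: yU | exact: xU].
have : 0 <= T x0 y0 + 0 by apply: (cvgr_to_ge TU); apply: nearW.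
(* With zero increments the identity turns the limit back into Minty's inequality at [(x0, y0)]. *)
have := cluster_identity x0 0 p u0 y0 0 q v0.
rewrite !scaler0 !oppr0 !addr0 !add0r => ->.
by rewrite !inner0l !mulr0 subr0 !addr0.
Qed.

End weak_cluster.

(** * Uniqueness of the weak limit and convergence of the whole sequence *)

Let merit_diff (p q : H * G) (X : H) (Y : G) :
  ((2 * tau)^-1 * inner (X - p.1) (X - p.1)
   + (2 * sigma)^-1 * inner (Y - p.2) (Y - p.2) - inner (L (X - p.1)) (Y - p.2))
  - ((2 * tau)^-1 * inner (X - q.1) (X - q.1)
   + (2 * sigma)^-1 * inner (Y - q.2) (Y - q.2) - inner (L (X - q.1)) (Y - q.2)) =
  inner X (L^* (p.2 - q.2) - tau^-1 *: (p.1 - q.1))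
  + inner Y (L (p.1 - q.1) - sigma^-1 *: (p.2 - q.2))
  + ((2 * tau)^-1 * (inner p.1 p.1 - inner q.1 q.1)
     + (2 * sigma)^-1 * (inner p.2 p.2 - inner q.2 q.2)
     - inner (L p.1) p.2 + inner (L q.1) q.2).
Proof.
case: p q => [p1 p2] [q1 q2] /=.
rewrite (innerDr _ _ Y) (innerC Y (L _)) !(adjointB Lb) !innerE !(adjointE Lb) !innerE.
rewrite (innerC p1 X) (innerC q1 X) (innerC p2 Y) (innerC q2 Y).
by field; rewrite !gt_eqF.
Qed.

(* Opial: the difference of the two merit functions is affine, hence has the
   same limit along both filters; monotonicity of [f] does the rest. *)
Lemma cp_weak_limit_unique (U1 U2 : set_system nat) (p q : H * G) :
  ProperFilter U1 -> ProperFilter U2 -> \oo `<=` U1 -> \oo `<=` U2 ->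
  saddle_point L f h p -> saddle_point L f h q ->
  (forall z, inner (x n.+1) z @[n --> U1] --> inner p.1 z) ->
  (forall z, inner (y n.+1) z @[n --> U1] --> inner p.2 z) ->
  (forall z, inner (x n.+1) z @[n --> U2] --> inner q.1 z) ->
  (forall z, inner (y n.+1) z @[n --> U2] --> inner q.2 z) ->
  p = q.
Proof.
move=> UF1 UF2 oo1 oo2 ps qs x1 y1 x2 y2.
pose dx := p.1 - q.1; pose dy := p.2 - q.2.
(* The pair [(u0, v0)] is minus the preconditioner metric applied to p - q, the linear part of the
   difference of the merits. *)
pose u0 := L^* dy - tau^-1 *: dx; pose v0 := L dx - sigma^-1 *: dy.
pose m (r : H * G) n := (2 * tau)^-1 * inner (x n.+1 - r.1) (x n.+1 - r.1)
  + (2 * sigma)^-1 * inner (y n.+1 - r.2) (y n.+1 - r.2)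
  - inner (L (x n.+1 - r.1)) (y n.+1 - r.2).
pose C := (2 * tau)^-1 * (inner p.1 p.1 - inner q.1 q.1)
  + (2 * sigma)^-1 * (inner p.2 p.2 - inner q.2 q.2)
  - inner (L p.1) p.2 + inner (L q.1) q.2.
have T_cvg : cvgn (fun n => inner (x n.+1) u0 + inner (y n.+1) v0).
  have -> : (fun n => inner (x n.+1) u0 + inner (y n.+1) v0) =
      (fun n => inner (x n.+1) u0 + inner (y n.+1) v0 + C - C).
    by apply/funext => n; rewrite addrK.
  apply: is_cvgB; last exact: is_cvg_cst.
  have <- : (fun n => m p n - m q n) =
      (fun n => inner (x n.+1) u0 + inner (y n.+1) v0 + C).
    by apply/funext => n; exact: merit_diff.
  exact: is_cvgB (cp_merit_cvg ps) (cp_merit_cvg qs).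
have [l Tl] : exists l : R,
    inner (x n.+1) u0 + inner (y n.+1) v0 @[n --> \oo] --> l.
  by eexists; exact: T_cvg.
have lim1 : inner p.1 u0 + inner p.2 v0 = l.
  apply: (cvg_unique (@norm_hausdorff _ _) (cvgD (x1 u0) (y1 v0))).
  exact: cvg_trans (cvg_app _ oo1) Tl.
have lim2 : inner q.1 u0 + inner q.2 v0 = l.
  apply: (cvg_unique (@norm_hausdorff _ _) (cvgD (x2 u0) (y2 v0))).
  exact: cvg_trans (cvg_app _ oo2) Tl.
(* Equal limits give 2 <L dx, dy> = |dx|^2 / tau + |dy|^2 / sigma, while monotonicity gives <L dx,
   dy> <= 0. This takes the place of positive definiteness of the metric, which may fail. *)
have := subdifferential_monotone fp ps.1 qs.1.
rewrite -/dx; have -> : - L^* p.2 - - L^* q.2 = - L^* dy by rewrite /dy (adjointB Lb) opprD.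
rewrite innerNl (innerC _ dx) -(adjointE Lb) => mono.
have diff : inner dx u0 + inner dy v0 = 0.
  by rewrite /dx /dy !(innerDl _ (- _)) !innerNl; lra.
move: diff; rewrite /u0 /v0 !innerDr !innerNr !innerZr -(adjointE Lb).
rewrite (innerC dy (L dx)) => diff.
have tx : 0 <= tau^-1 * inner dx dx by rewrite mulr_ge0 ?inner_ge0// invr_ge0 ltW.
have sy : 0 <= sigma^-1 * inner dy dy.
  by rewrite mulr_ge0 ?inner_ge0// invr_ge0 ltW.
have zero (V : hilbertType R) (z : V) c : 0 < c -> c^-1 * inner z z = 0 -> z = 0.
  move=> c0 /eqP; rewrite mulf_eq0 invr_eq0 gt_eqF//= inner_normE sqrf_eq0.
  by rewrite normr_eq0 => /eqP.
have dx0 : dx = 0 by apply: zero tau_gt0 _; lra.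
have dy0 : dy = 0 by apply: zero sigma_gt0 _; lra.
by apply: injective_projections; apply/eqP; rewrite -subr_eq0; apply/eqP.
Qed.

Lemma cp_weak_limit (fc : convex_ereal f) (fl : lower_semicontinuous f)
    (hc : convex_ereal h) (hl : lower_semicontinuous h) :
  (exists p, saddle_point L f h p) ->
  exists2 p, saddle_point L f h p & forall u0 v0,
    inner (x n) u0 + inner (y n) v0 @[n --> \oo] --> inner p.1 u0 + inner p.2 v0.
Proof.
move=> [p0 p0s]; have [M xyM] := cp_bounded p0s.
have cluster (U : set_system nat) : UltraFilter U -> \oo `<=` U ->
    exists2 p, saddle_point L f h p &
      (forall z, inner (x n.+1) z @[n --> U] --> inner p.1 z) /\
      (forall z, inner (y n.+1) z @[n --> U] --> inner p.2 z).
  move=> UU ooU.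
  have [x1 xU] : exists x1, forall z, inner (x n.+1) z @[n --> U] --> inner x1 z.
    by apply: (@ultra_weak_cvg _ _ _ _ _ M) => //; apply: nearW => n; case: (xyM n).
  have [y1 yU] : exists y1, forall z, inner (y n.+1) z @[n --> U] --> inner y1 z.
    by apply: (@ultra_weak_cvg _ _ _ _ _ M) => //; apply: nearW => n; case: (xyM n).
  exists (x1, y1) => //.
  exact: cp_weak_cluster xyM (cp_increment_x p0s) (cp_increment_y p0s) xU yU.
(* One ultrafilter fixes the candidate [p]; every other has the same limit, so the whole sequence
   converges. *)
have [U0 [UU0 ooU0]] := ultraFilterLemma eventually_filter.
have [p ps [xp yp]] := cluster U0 UU0 ooU0.
exists p => // u0 v0; rewrite -cvg_shiftS /=; apply: cvg_ultraP => U UU ooU.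
have [q qs [xq yq]] := cluster U UU ooU.
rewrite (cp_weak_limit_unique _ _ ooU0 ooU ps qs xp yp xq yq).
by apply: cvgD; [exact: xq | exact: yq].
Qed.

End chambolle_pock_convergence.

(** * Functionals on the product space and the convergence theorem *)

Lemma riesz_prod (R : realType) (H G : hilbertType R)
    (phi : {linear (H * G)%type -> R^o}) : continuous phi ->
  exists u v, forall z, phi z = inner z.1 u + inner z.2 v.
Proof.
move=> /linear_bounded_continuous/linear_boundedP/pinfty_ex_gt0[M _ phiM].
have [u uE] : exists u : H, forall z, phi (z, 0) = inner z u.
  apply: (@riesz _ _ (fun z => phi (z, 0)) M) => [a z z'|z].
    have -> : (a *: z + z', 0 : G) = a *: (z, 0) + (z', 0).
      by apply: injective_projections; rewrite /= ?scaler0 ?addr0.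
    by rewrite linearP.
  (* On each factor the maximum norm reduces to the Hilbert norm, so Riesz applies to each factor
     separately. *)
  by apply: le_trans (phiM _) _; rewrite prod_normE /= normr0 (max_idPl _).
have [v vE] : exists v : G, forall z, phi (0, z) = inner z v.
  apply: (@riesz _ _ (fun z => phi (0, z)) M) => [a z z'|z].
    have -> : (0 : H, a *: z + z') = a *: (0, z) + (0, z').
      by apply: injective_projections; rewrite /= ?scaler0 ?addr0.
    by rewrite linearP.
  by apply: le_trans (phiM _) _; rewrite prod_normE /= normr0 (max_idPr _).
exists u, v => -[z1 z2] /=; rewrite -uE -vE -linearD; congr (phi (_, _)).
  by rewrite addr0.
by rewrite add0r.
Qed.

Theorem theorem2 (R : realType) (H G : hilbertType R)
    (f : H -> \bar R) (g : G -> \bar R) (L : {linear H -> G})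
    (f_proper : proper_ereal f) (f_convex : convex_ereal f)
    (f_lsc : lower_semicontinuous f)
    (g_proper : proper_ereal g) (g_convex : convex_ereal g)
    (g_lsc : lower_semicontinuous g)
    (L_bounded : bounded_operator L) (L_neq0 : exists x, L x != 0)
    (KKT_ex : exists p : H * G, KKT_point f g L p)
    (theta tau sigma : R) (theta_gt : 1 / 2 < theta)
    (tau_gt0 : 0 < tau) (sigma_gt0 : 0 < sigma)
    (step_lt : tau * sigma * opnorm L ^+ 2 < 4 / (1 + 2 * theta))
    (x : nat -> H) (y : nat -> G)
    (xy_cp : chambolle_pock f g L tau sigma theta x y) :
  exists p : H * G, KKT_point f g L p /\
    weakly_cvg (fun k => (x k, y k)) p.
Proof.
have gp := conjugate_proper g_proper g_convex g_lsc.
have gc := conjugate_convex g_proper.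
have gl := conjugate_lsc g_proper.
(* The prox steps are used from here on only through their optimality conditions. *)
have xu n : subdifferential f (x n.+1)
    (- (tau^-1 *: (x n.+1 - x n)) - adjoint L (y n)).
  have := proxP (x n - tau *: adjoint L (y n)) tau_gt0 f_proper f_convex f_lsc.
  rewrite -(xy_cp n).1; congr (subdifferential _ _ _).
  rewrite -[in RHS]scalerN opprB addrAC scalerBr scalerA mulVf ?scale1r//.
  by rewrite gt_eqF.
have yv n : subdifferential (conjugate g) (y n.+1)
    (- (sigma^-1 *: (y n.+1 - y n))
     + L (x n.+1 + theta *: (x n.+1 - x n))).
  have := proxP (y n + sigma *: L (x n.+1 + theta *: (x n.+1 - x n)))
    sigma_gt0 gp gc gl.
  rewrite -(xy_cp n).2; congr (subdifferential _ _ _).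
  rewrite -[in RHS]scalerN opprB addrAC scalerDr scalerA mulVf ?scale1r//.
  by rewrite gt_eqF.
have [p ps xyp] := cp_weak_limit L_bounded f_proper gp theta_gt tau_gt0
  sigma_gt0 step_lt xu yv f_convex f_lsc gc gl KKT_ex.
exists p; split=> // phi /riesz_prod[u [v phiE]].
have -> : (fun k => phi (x k, y k)) = (fun k => inner (x k) u + inner (y k) v).
  by apply/funext => k; rewrite phiE.
by rewrite phiE; exact: xyp.
Qed.
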